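(* Let $P$ and $Q$ be posets such that the set $Id(P)$ of all non-trivial ideals of $P$ and the set $Id(Q)$ of all non-trivial ideals of $Q$ are both countable. Then $\Sigma(P\times Q)=\Sigma P\times\Sigma Q$, i.e. the Scott topology on the product poset $P\times Q$ coincides with the product topology of the Scott topologies $\sigma(P)$ and $\sigma(Q)$.
   Context: A nonempty subset $D$ of a poset $P$ is directed if every two elements of $D$ have an upper bound in $D$. An ideal of $P$ is a directed lower set. An ideal is non-trivial if it has no greatest element; $Id(P)$ denotes the set of all non-trivial ideals of $P$. A subset $U$ of $P$ is Scott open if it is an upper set and, for every directed $D\subseteq P$ whose supremum exists with $\sup D\in U$, one has $D\cap U\neq\emptyset$. The Scott open sets form the Scott topology $\sigma(P)$, and $\Sigma P=(P,\sigma(P))$ is the Scott space of $P$. The product poset $P\times Q$ carries the componentwise order. *)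

(* Defs.v *)
From HB Require Import structures.
From mathcomp Require Import all_boot all_order.
From mathcomp Require Import all_classical topology.

Set Implicit Arguments.
Unset Strict Implicit.
Unset Printing Implicit Defensive.

Import Order.TTheory.
Local Open Scope classical_set_scope.
Local Open Scope order_scope.

Section Posets.
Context {d : Order.disp_t} {P : porderType d}.
Implicit Types A D I U : set P.

Definition lower_set A := forall x y, x <= y -> A y -> A x.

Definition upper_set A := forall x y, x <= y -> A x -> A y.

Definition directed D :=
  D !=set0 /\
  forall x y, D x -> D y -> exists z, [/\ D z, x <= z & y <= z].

Definition ideal I := directed I /\ lower_set I.

Definition nontrivial_ideal I := ideal I /\ ~ exists2 m, I m & ubound I m.

Definition scott_open U :=
  upper_set U /\
  forall D s, directed D -> isLub D s -> U s -> D `&` U !=set0.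

Lemma scott_openT : scott_open setT.
Proof. by split=> // D s [[x Dx] _] _ _; exists x. Qed.

Lemma scott_openI : setI_closed scott_open.
Proof.
move=> U V [upU oU] [upV oV]; split=> [x y xy [Ux Vx]|D s dD Ds [Us Vs]].
  by split; [exact: upU xy Ux|exact: upV xy Vx].
have [x [Dx Ux]] := oU D s dD Ds Us; have [y [Dy Vy]] := oV D s dD Ds Vs.
have [z [Dz xz yz]] := dD.2 x y Dx Dy.
by exists z; split=> //; split; [exact: upU xz Ux|exact: upV yz Vy].
Qed.

Lemma scott_open_bigU (J : Type) (f : J -> set P) :
  (forall j, scott_open (f j)) -> scott_open (\bigcup_j f j).
Proof.
move=> of_; split=> [x y xy [j _ fx]|D s dD Ds [j _ fs]].
  by exists j => //; exact: (of_ j).1 xy fx.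
have [x [Dx fx]] := (of_ j).2 D s dD Ds fs.
by exists x; split=> //; exists j.
Qed.

End Posets.

Definition nontrivial_ideals {d : Order.disp_t} (P : porderType d) :
    set (set P) :=
  [set I | nontrivial_ideal I].
Arguments nontrivial_ideals {d} P _ : assert.

(* The Scott space: an alias of the carrier, so that the Scott topology is
   not confused with another one (e.g. the product topology on [P *p Q]). *)
Definition scott {d : Order.disp_t} (P : porderType d) : Type := P.

HB.instance Definition _ (d : Order.disp_t) (P : porderType d) :=
  Choice.copy (scott P) P.

HB.instance Definition _ (d : Order.disp_t) (P : porderType d) :=
  @isOpenTopological.Build (scott P) (@scott_open d P)
    scott_openT scott_openI scott_open_bigU.

Lemma scott_openE {d : Order.disp_t} (P : porderType d) :
  (open : set_system (scott P)) = scott_open.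
Proof. by []. Qed.

Lemma leq_prodE {d d' : Order.disp_t} (P : porderType d) (Q : porderType d')
    (x y : P *p Q) :
  (x <= y) = (x.1 <= y.1) && (x.2 <= y.2).
Proof. by []. Qed.

(* Main.v *)
(* Let W be Scott open in P * Q and (a, b) in W. Starting from {a} and {b},
   grow finite sets A_n and B_n with A_n * B_n inside W: at stage n, look at one
   non-trivial ideal I of P and, if its supremum lies above a point of A_n, add
   to A_n a point x of I with {x} * B_n inside W; it exists because B_n is
   finite, I is directed and the slices of W are Scott open. Do the same in Q.
   When every non-trivial ideal is looked at infinitely often, which
   countability allows, the upper closures of the unions of the A_n and of the
   B_n are Scott open, and their product is a neighbourhood of (a, b) inside
   W. *)
Require Import Defs.
From mathcomp Require Import all_boot all_order.
From mathcomp Require Import all_classical topology.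

Import Order.TTheory.
Local Open Scope classical_set_scope.

(** Each exponent of 2 occurs in arbitrarily large numbers, so decoding [n] through [logn 2 n] meets
    every code again and again. *)
Lemma countable_recurrent_enum (T : choiceType) (t0 : T) (A : set T) :
  countable A ->
  exists e : nat -> T,
    forall x, A x -> forall N, exists2 n, (N <= n)%N & e n = x.
Proof.
move=> /countable_injP[f finj].
exists (fun n => xget t0 (A `&` f @^-1` [set logn 2 n])) => x Ax N.
(* The odd factor [N.*2.+1] keeps the exponent of 2 at [f x] and pushes the index beyond [N]. *)
exists (2 ^ f x * N.*2.+1)%N.
  rewrite (@leq_trans N.*2.+1) ?leq_pmull ?expn_gt0//.
  by rewrite -addnn ltnW// ltnS leq_addr.
rewrite lognM ?expn_gt0// pfactorK// lognE/= dvdn2/= odd_double/= addn0.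
apply: xget_unique => // y [Ay /= fyx].
by apply: finj; rewrite ?inE.
Qed.

Section Posets.
Context {d : Order.disp_t} {P : porderType d}.
Implicit Types (A : seq P) (D I : set P).

(** Induction on [B]: a bound in [D] of the point found so far and a point for the new [b] serves
    both, the sections of [R] being upper sets. *)
Lemma directed_common (T : eqType) (R : P -> T -> Prop) D (B : seq T) :
  directed D -> (forall b, upper_set (R^~ b)) ->
  (forall b, b \in B -> exists2 x, D x & R x b) ->
  exists2 x, D x & forall b, b \in B -> R x b.
Proof.
move=> [[x0 Dx0] dD] upR; elim: B => [|b B IH] RB; first by exists x0.
have [c Bc|x Dx xB] := IH; first by apply: RB; rewrite inE Bc orbT.
have [y Dy yb] := RB b (mem_head _ _).
have [z [Dz xz yz]] := dD x y Dx Dy.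
exists z => // c; rewrite inE => /predU1P[->|Bc]; first exact: upR yz yb.
by apply: upR xz _; exact: xB.
Qed.

Definition lower_closure D : set P := [set x | exists2 y, D y & (x <= y)%O].

Lemma directed_ideal D : directed D -> ideal (lower_closure D).
Proof.
move=> [[x Dx] dD]; split; last first.
  by move=> y z yz [w Dw zw]; exists w => //; exact: le_trans zw.
split=> [|y z [y' Dy' yy'] [z' Dz' zz']]; first by exists x, x.
have [w [Dw y'w z'w]] := dD _ _ Dy' Dz'.
exists w; split; [by exists w| |]; [exact: le_trans y'w|exact: le_trans z'w].
Qed.

Lemma isLub_lower_closure D s : isLub D s -> isLub (lower_closure D) s.
Proof.
move=> [Ds lubs]; split=> [x [y Dy xy]|b Db]; first exact: le_trans (Ds y Dy).
by apply: lubs => x Dx; apply: Db; exists x.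
Qed.

Definition catches I A A' := directed I ->
  forall s a, isLub I s -> a \in A -> (a <= s)%O -> exists2 x, x \in A' & I x.

(** A directed set and the ideal it generates have the same supremum. If the ideal has a greatest
    element, this is above the supremum and below a point of [D]. Otherwise the ideal returns at a
    stage after [a] has entered, and the point caught there lies below a point of [D]. *)
Lemma catches_scott_open (e : nat -> set P) (A : nat -> seq P) :
  (forall I, nontrivial_ideal I -> forall N, exists2 n, (N <= n)%N & e n = I) ->
  (forall n, {subset A n <= A n.+1}) ->
  (forall n, catches (e n) (A n) (A n.+1)) ->
  scott_open [set x | exists n, exists2 a, a \in A n & (a <= x)%O].
Proof.
move=> eP Amono Acatch.
have Ale m n : (m <= n)%N -> {subset A m <= A n}.
  move=> /subnKC <-; elim: (n - m)%N => [|k IH] x Ax; first by rewrite addn0.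
  by rewrite addnS; apply/Amono/IH.
split=> [x y xy [n [a Aa ax]]|D s dD Ds [m [a Aa as_]]].
  by exists n, a => //; exact: le_trans xy.
have idI := directed_ideal _ dD; have lubI := isLub_lower_closure _ _ Ds.
have [[t [y Dy ty] It]|ntI] :=
    pselect (exists2 t, lower_closure D t & ubound (lower_closure D) t).
  exists y; split=> //; exists m, a => //.
  apply: (le_trans as_); apply: (le_trans _ ty); exact: lubI.2.
have [n mn enI] := eP _ (conj idI ntI) m.
have := Acatch n; rewrite enI => /(_ idI.1 s a lubI (Ale _ _ mn _ Aa) as_).
by case=> x Ax [y Dy xy]; exists y; split=> //; exists n.+1, x.
Qed.

End Posets.

(** A supremum [s] above a point of [A] lies in every section [R^~ b] with [b] in [B], so [I] meets
    each of them, hence all at one point. The relation [R] is abstract so that the two factors can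
    exchange roles. *)
Lemma catch_step {d d' : Order.disp_t} {P : porderType d} {Q : porderType d'}
    (R : P -> Q -> Prop) (I : set P) (A : seq P) (B : seq Q) :
  (forall b, scott_open (R^~ b)) ->
  (forall a b, a \in A -> b \in B -> R a b) ->
  exists A', [/\ {subset A <= A'}, catches I A A' &
                 forall a b, a \in A' -> b \in B -> R a b].
Proof.
move=> oR RAB.
have [[dI [s [a [Is Aa as_]]]]|nI] :=
    pselect (directed I /\ exists s a, [/\ isLub I s, a \in A & (a <= s)%O]);
  last first.
  exists A; split=> // dI s a Is Aa as_; exfalso; apply: nI; split=> //.
  by exists s, a.
have [//|b|b Bb|x Ix xB] := @directed_common _ _ _ R I B.
- exact: (oR b).1.
- have Rsb : R s b by apply: (oR b).1 as_ _; exact: RAB.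
  by have [x [Ix xb]] := (oR b).2 I s dI Is Rsb; exists x.
exists (x :: A); split=> [c Ac|_ _ _ _ _ _|c b].
- by rewrite inE Ac orbT.
- by exists x; rewrite ?mem_head.
- by rewrite inE => /predU1P[->|Ac] Bb; [exact: xB|exact: RAB].
Qed.

Lemma separately_scott_open_box {d d' : Order.disp_t} {P : porderType d}
    {Q : porderType d'} (W : set (P * Q)) (a : P) (b : Q) :
  countable (nontrivial_ideals P) -> countable (nontrivial_ideals Q) ->
  (forall y, scott_open [set x | W (x, y)]) ->
  (forall x, scott_open [set y | W (x, y)]) ->
  W (a, b) ->
  exists U V, [/\ scott_open U, scott_open V, U a, V b & U `*` V `<=` W].
Proof.
(* The default [set0] is not directed, so [catches] asks nothing of it. *)
move=> /(countable_recurrent_enum _ set0)[e eP].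
move=> /(countable_recurrent_enum _ set0)[f fQ] oWl oWr Wab.
pose box (p : seq P * seq Q) :=
  forall x y, x \in p.1 -> y \in p.2 -> W (x, y).
(* With [box np.2] as a premise, [step] can be chosen as a total function; [boxF] then discharges
   the premise along [F]. *)
pose next (np : nat * (seq P * seq Q)) p' := box np.2 ->
  [/\ box p', {subset np.2.1 <= p'.1}, {subset np.2.2 <= p'.2},
      catches (e np.1) np.2.1 p'.1 & catches (f np.1) np.2.2 p'.2].
have [step stepP] : {step & forall np, next np (step np)}.
  apply: choice => -[n [A B]].
  have [boxAB|nbox] := pselect (box (A, B)); last by exists (A, B).
  have [A' [AA' cA A'B]] :=
    catch_step (fun x y => W (x, y)) (e n) A B oWl boxAB.
  (* [B] grows against the enlarged [A'], so that the new box still fits in [W]. *)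
  have [B' [BB' cB B'A]] := catch_step (fun y x => W (x, y)) (f n) B A' oWr
    (fun y x By Ax => A'B x y Ax By).
  by exists (A', B') => _; split=> // x y Ax By; exact: B'A.
pose F := fix F n := if n is m.+1 then step (m, F m) else ([:: a], [:: b]).
have boxF n : box (F n).
  elim: n => [x y|n IH]; first by rewrite !inE => /eqP-> /eqP->.
  by case: (stepP (n, F n) IH).
exists [set x | exists n, exists2 c, c \in (F n).1 & (c <= x)%O].
exists [set y | exists n, exists2 c, c \in (F n).2 & (c <= y)%O].
have F1 n : {subset (F n).1 <= (F n.+1).1} by case: (stepP (n, F n) (boxF n)).
have F2 n : {subset (F n).2 <= (F n.+1).2} by case: (stepP (n, F n) (boxF n)).
split.
- apply: (catches_scott_open e) => // n.
  by case: (stepP (n, F n) (boxF n)).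
- apply: (catches_scott_open f) => // n.
  by case: (stepP (n, F n) (boxF n)).
- by exists 0, a; rewrite ?inE.
- by exists 0, b; rewrite ?inE.
(* The two coordinates may be bounded below at different stages; the later stage contains both
   bounds. *)
have leF m n : (m <= n)%N ->
    {subset (F m).1 <= (F n).1} /\ {subset (F m).2 <= (F n).2}.
  move=> /subnKC <-; elim: (n - m)%N => [|k [IH1 IH2]].
    by rewrite addn0; split.
  by rewrite addnS; split=> z Fz; [exact: F1 (IH1 _ Fz)|exact: F2 (IH2 _ Fz)].
move=> [x y] [[m [u Fu ux]] [n [v Fv vy]]].
apply: (oWl y).1 ux _; apply: (oWr u).1 vy _; apply: (boxF (maxn m n)).
- by case: (leF _ _ (leq_maxl m n)) => le1 _; exact: le1.
- by case: (leF _ _ (leq_maxr m n)) => _ le2; exact: le2.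
Qed.

Definition scott_continuous {d d' : Order.disp_t} {P : porderType d}
    {Q : porderType d'} (f : P -> Q) :=
  {homo f : x y / (x <= y)%O} /\
  forall D s, directed D -> isLub D s -> isLub (f @` D) (f s).

Lemma scott_open_preimage {d d' : Order.disp_t} {P : porderType d}
    {Q : porderType d'} (f : P -> Q) (U : set Q) :
  scott_continuous f -> scott_open U -> scott_open (f @^-1` U).
Proof.
move=> [fmono flub] [upU oU]; split=> [x y xy|D s dD Ds Us].
  by apply: upU; exact: fmono.
have [|_ [[x Dx <-] Ufx]] := oU (f @` D) (f s) _ (flub D s dD Ds) Us.
  case: dD => [[x0 Dx0] dD]; split=> [|_ _ [x Dx <-] [y Dy <-]].
    by exists (f x0), x0.
  have [z [Dz xz yz]] := dD _ _ Dx Dy.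
  by exists (f z); split; [exists z|exact: fmono|exact: fmono].
by exists x.
Qed.

Section ProductMaps.
Context {d d' : Order.disp_t} {P : porderType d} {Q : porderType d'}.

Lemma scott_continuous_pairl (y : Q) :
  scott_continuous (fun x => (x, y) : P *p Q).
Proof.
split=> [x x' xx'|D s [[x0 Dx0] _] [Ds lubs]].
  by rewrite leq_prodE /= xx' lexx.
split=> [_ [x Dx <-]|[x z] ub]; rewrite leq_prodE /=.
  by rewrite lexx andbT; exact: Ds.
have {}ub w (Dw : D w) : (w <= x)%O && (y <= z)%O.
  by rewrite -(leq_prodE (w, y) (x, z)); apply: ub; exists w.
(* Nonemptiness of [D] gives the bound on the constant coordinate. *)
have /andP[_ ->] := ub _ Dx0; rewrite andbT.
by apply: lubs => w /ub/andP[].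
Qed.

Lemma scott_continuous_swap :
  scott_continuous (fun p : P *p Q => (p.2, p.1) : Q *p P).
Proof.
have swap_le (x y : P *p Q) :
    (((x.2, x.1) : Q *p P) <= ((y.2, y.1) : Q *p P))%O = (x <= y)%O.
  by rewrite !leq_prodE /= andbC.
split=> [x y|D s _ [Ds lubs]]; first by rewrite swap_le.
split=> [_ [x Dx <-]|[y x] ub]; first by rewrite swap_le; exact: Ds.
rewrite (swap_le s (x, y)); apply: lubs => p Dp.
by rewrite -swap_le; apply: ub; exists p.
Qed.

Lemma scott_continuous_fst : scott_continuous (fun p : P *p Q => p.1).
Proof.
split=> [x y|D s _ [Ds lubs]]; first by rewrite leq_prodE => /andP[].
split=> [_ [x Dx <-]|x ub]; first by have /andP[] := Ds x Dx.
(* Replacing the first coordinate of [s] by [x] still bounds [D], so the least bound [s] is below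
   the result. *)
have /andP[] // : (s <= ((x, s.2) : P *p Q))%O.
apply: lubs => p Dp; rewrite leq_prodE /=; apply/andP; split.
  by apply: ub; exists p.
by have /andP[] := Ds p Dp.
Qed.

End ProductMaps.

(* Both sides are set systems on the pairs P * Q: [P *p Q] is the product poset
   (componentwise order), and the right-hand topology is the product one. *)
Theorem lemma3p1 (d d' : Order.disp_t) (P : porderType d) (Q : porderType d')
    (countable_IdP : countable (nontrivial_ideals P))
    (countable_IdQ : countable (nontrivial_ideals Q)) :
  (open : set_system (scott (P *p Q)%type)) =
  (open : set_system (scott P * scott Q)%type).
Proof.
have fst_open (U : set P) : scott_open U -> scott_open [set p : P *p Q | U p.1].
  by move=> oU; exact: scott_open_preimage scott_continuous_fst oU.
have snd_open (V : set Q) : scott_open V -> scott_open [set p : P *p Q | V p.2].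
  move=> oV; have oV1 : scott_open [set p : Q *p P | V p.1].
    exact: scott_open_preimage scott_continuous_fst oV.
  exact: scott_open_preimage scott_continuous_swap oV1.
apply/seteqP; split=> W oW.
  have oWl y : scott_open [set x : P | W (x, y)].
    exact: scott_open_preimage (scott_continuous_pairl y) oW.
  have oWr x : scott_open [set y : Q | W (x, y)].
    have oW' : scott_open [set p : Q *p P | W (p.2, p.1)].
      exact: scott_open_preimage scott_continuous_swap oW.
    exact: scott_open_preimage (scott_continuous_pairl x) oW'.
  rewrite openE => -[a b] Wab.
  have [U [V [oU oV Ua Vb UVW]]] :=
    separately_scott_open_box W a b countable_IdP countable_IdQ oWl oWr Wab.
  exists (U, V) => //; split; exact: (@open_nbhs_nbhs (scott _)).
rewrite openE; move: oW; rewrite openE => oW [a b] Wab.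
have [[A B] /= []] := oW _ Wab.
rewrite !nbhsE /= => -[U [oU Ua] UA] [V [oV Vb] VB] ABW.
(* Conversely, an open box is the intersection of the preimages of its sides under the
   projections. *)
have oUV : scott_open [set p : P *p Q | U p.1 /\ V p.2].
  exact: scott_openI (fst_open _ oU) (snd_open _ oV).
exists [set p | U p.1 /\ V p.2]; split=> [||[x y] [/= Ux Vy]] //.
by apply: ABW; split; [exact: UA|exact: VB].
Qed.
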